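(* Let $f \in L(X^o)$ and $g \in L(\partial X)$. If the matrix $$S = (I_{X^o} - P_{X^o})^2 + P_{X^o,\partial X} P_{\partial X, X^o}$$ is invertible -- in particular, if $P$ is reversible -- the boundary value problem $$\Delta^2 u = f \ \text{ on } X^o \quad\text{and}\quad u = g\ \text{ on }\partial X$$ has a unique solution $u\in L(X)$. It is given by $$u = K_{X^o}G_{X^o}(f + Ug) \quad \text{on } X^o,$$ where the $X^o \times \partial X$-matrix $U$ is given by $$U = (I_{X^o} - P_{X^o})P_{X^o,\partial X} + P_{X^o,\partial X}(I_{\partial X} - P_{\partial X}).$$
   Context: Let $(X,E)$ be a finite directed graph with $|X|\ge 2$, $E\subset X^2$ without loops, which is strongly connected. Each edge $(x,y)\in E$ carries a weight $a(x,y)>0$, and $a(x,y)=0$ if $(x,y)\notin E$. Put $m(x)=\sum_y a(x,y)$, $p(x,y)=a(x,y)/m(x)$, $P=(p(x,y))_{x,y\in X}$. $L(B)$ is the space of functions $B\to\mathbb{C}$ (column vectors), $Pu(x)=\sum_y p(x,y)u(y)$, and $\Delta=P-I$. $\pi$ denotes the unique stationary probability distribution of $P$ ($\pi P=\pi$, $\pi>0$, total mass $1$). $P$ is reversible if $\pi(x)p(x,y)=\pi(y)p(y,x)$ for all $x,y\in X$. The boundary $\partial X$ is an arbitrary non-empty subset of $X$, and $X^o=X\setminus\partial X$. For $A,B\subset X$, $P_{A,B}=(p(x,y))_{x\in A,y\in B}$ and $P_A=P_{A,A}$. $G_{X^o}=(I_{X^o}-P_{X^o})^{-1}$ (the inverse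 exists), $\Upsilon=G_{X^o}P_{X^o,\partial X}$, and $K_{X^o}=(I_{X^o}-P_{X^o}+\Upsilon P_{\partial X,X^o})^{-1}$. One has $S=(I_{X^o}-P_{X^o})(I_{X^o}-P_{X^o}+\Upsilon P_{\partial X,X^o})$, so $K_{X^o}$ exists if and only if $S$ is invertible. *)

(* Defs.v *)
From HB Require Import structures.
From mathcomp Require Import all_boot all_order all_algebra.
From mathcomp Require Import reals.
From mathcomp Require Import complex.

Set Implicit Arguments.
Unset Strict Implicit.
Unset Printing Implicit Defensive.

Import Order.TTheory GRing.Theory Num.Theory.
Local Open Scope ring_scope.
Local Open Scope complex_scope.

Section Digraph.
Variables (R : realType) (X : finType).

Definition weighted_digraph (E : rel X) (a : X -> X -> R) : Prop :=
  [/\ irreflexive E,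
      forall x y : X, connect E x y,
      forall x y : X, E x y -> 0 < a x y
    & forall x y : X, ~~ E x y -> a x y = 0].

Definition mass (a : X -> X -> R) (x : X) : R := \sum_(y : X) a x y.

Definition trans (a : X -> X -> R) (x y : X) : R := a x y / mass a x.

Definition stationary_distribution (p : X -> X -> R) (pi : X -> R) : Prop :=
  [/\ forall x : X, 0 < pi x,
      \sum_(x : X) pi x = 1
    & forall y : X, \sum_(x : X) pi x * p x y = pi y].

(* For a strongly connected graph the stationary distribution exists and is
   unique, so the existential refers to that distribution. *)
Definition reversible (p : X -> X -> R) : Prop :=
  exists pi : X -> R, stationary_distribution p pi /\
    forall x y : X, pi x * p x y = pi y * p y x.

(* L(X) is {ffun X -> R[i]}; for B : {set X}, L(B) is 'cV[R[i]]_#|B|, the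
   coordinate i standing for the vertex enum_val i of B. *)
Definition laplacian (p : X -> X -> R) (u : {ffun X -> R[i]}) :
    {ffun X -> R[i]} :=
  [ffun x => \sum_(y : X) (p x y)%:C * u y - u x].

Definition restr (B : {set X}) (u : {ffun X -> R[i]}) : 'cV[R[i]]_#|B| :=
  \col_(i < #|B|) u (enum_val i).

Definition blockP (p : X -> X -> R) (A B : {set X}) : 'M[R[i]]_(#|A|, #|B|) :=
  \matrix_(i < #|A|, j < #|B|) (p (enum_val i) (enum_val j))%:C.

Section Boundary.
(* bX is the boundary; the interior X^o is ~: bX. *)
Variables (p : X -> X -> R) (bX : {set X}).

Definition IP : 'M[R[i]]_#|~: bX| := 1%:M - blockP p (~: bX) (~: bX).

Definition green : 'M[R[i]]_#|~: bX| := invmx IP.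

Definition Upsilon : 'M[R[i]]_(#|~: bX|, #|bX|) :=
  green *m blockP p (~: bX) bX.

Definition IPY : 'M[R[i]]_#|~: bX| := IP + Upsilon *m blockP p bX (~: bX).

Definition kernelK : 'M[R[i]]_#|~: bX| := invmx IPY.

Definition matS : 'M[R[i]]_#|~: bX| :=
  IP ^+ 2 + blockP p (~: bX) bX *m blockP p bX (~: bX).

Definition matU : 'M[R[i]]_(#|~: bX|, #|bX|) :=
  IP *m blockP p (~: bX) bX
  + blockP p (~: bX) bX *m (1%:M - blockP p bX bX).

Definition bilaplace_bvp (f : 'cV[R[i]]_#|~: bX|) (g : 'cV[R[i]]_#|bX|)
    (u : {ffun X -> R[i]}) : Prop :=
  restr (~: bX) (laplacian p (laplacian p u)) = f /\ restr bX u = g.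

End Boundary.
End Digraph.

(* Main.v *)
Require Import Defs.
From HB Require Import structures.
From mathcomp Require Import all_boot all_order all_algebra.
From mathcomp Require Import reals.
From mathcomp Require Import complex.

Import Order.TTheory GRing.Theory Num.Theory.
Local Open Scope ring_scope.
Local Open Scope complex_scope.

(** Write [A = I - P] on the interior, [B] and [C] for the blocks of [P] from
    the interior to the boundary and back, and [D = I - P] on the boundary.
    Then [- Delta] is the block matrix with rows [(A, -B)] and [(-C, D)], so
    the interior rows of [Delta ^ 2] are [(A ^ 2 + B C, - (A B + B D))], that
    is [(S, - U)].  With [u = g] on the boundary the problem is therefore the
    linear system [S u = f + U g] on the interior ([bilaplace_bvpE]), uniquely
    solvable when [S] is invertible.  Since [S = A (A + G B C)] ([matS_IPY]),
    the inverse of [S] is [K G], which is the announced formula.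

    The two invertibility claims are kernel computations.  A kernel vector,
    extended by 0 to the boundary, is a function [u] on [X]; its real and
    imaginary parts can be treated separately because [P] is real.
    - For [A], [u] is harmonic on the interior and 0 on the boundary, and the
      maximum principle ([harmonic_le0]), applied to the real and imaginary
      parts and to their opposites, gives [u = 0]: the set where the maximum
      is reached is closed under following edges until it meets the boundary,
      and the graph is strongly connected.
    - For [S], [Delta ^ 2 u = 0] on the interior and [u = 0] on the boundary.
      When [P] is reversible, [Delta] is symmetric for the inner product
      weighted by [pi], so [|Delta u| ^ 2 = <u, Delta ^ 2 u> = 0]
      ([reversible_biharmonic]); hence [u] is harmonic and the first case
      applies. *)

(** * Real functions on a weighted digraph *)

Section RealLaplacian.
Set Implicit Arguments.
Unset Strict Implicit.
Variables (R : realType) (X : finType).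

Definition real_laplacian (p : X -> X -> R) (h : X -> R) (x : X) : R :=
  \sum_(y : X) p x y * h y - h x.

Lemma real_laplacianN (p : X -> X -> R) (h : X -> R) (x : X) :
  real_laplacian p (fun y => - h y) x = - real_laplacian p h x.
Proof.
rewrite /real_laplacian opprB opprK addrC; congr (_ + _).
by rewrite -sumrN; apply: eq_bigr => y _; rewrite mulrN.
Qed.

Lemma eq_real_laplacian (p : X -> X -> R) (h k : X -> R) :
  h =1 k -> real_laplacian p h =1 real_laplacian p k.
Proof.
by move=> hk x; rewrite /real_laplacian hk; under eq_bigr do rewrite hk.
Qed.

(** Both sides are sums over pairs of vertices against the conductances
    [pi x * p x y], which detailed balance makes symmetric. *)
Lemma real_laplacian_sym (p : X -> X -> R) (pi h k : X -> R) :
  (forall x y, pi x * p x y = pi y * p y x) ->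
  \sum_x pi x * (h x * real_laplacian p k x)
  = \sum_x pi x * (real_laplacian p h x * k x).
Proof.
move=> rev.
under eq_bigr do rewrite mulrBr mulrBr mulr_sumr mulr_sumr.
under [RHS]eq_bigr do rewrite mulrBl mulrBr mulr_suml mulr_sumr.
rewrite !sumrB; congr (_ - _); rewrite exchange_big /=.
apply: eq_bigr => x _; apply: eq_bigr => y _.
by rewrite !mulrA rev [pi y * h y * _]mulrAC.
Qed.

(** For a reversible chain, [h] vanishing on the boundary and [Delta ^ 2 h]
    vanishing off it make [<h, Delta ^ 2 h>] zero, and by symmetry this is the
    squared [pi]-norm of [Delta h]. *)
Lemma reversible_biharmonic (p : X -> X -> R) (bX : {set X}) (h : X -> R) :
  reversible p ->
  (forall x, x \in bX -> h x = 0) ->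
  (forall x, x \notin bX -> real_laplacian p (real_laplacian p h) x = 0) ->
  forall x, real_laplacian p h x = 0.
Proof.
move=> [pi [[pi_gt0 _ _] rev]] h0 lap0 x.
have /eqP : \sum_x pi x * (real_laplacian p h x * real_laplacian p h x) = 0.
  rewrite -real_laplacian_sym // big1 // => y _.
  case: (boolP (y \in bX)) => yb; first by rewrite h0 ?mul0r ?mulr0.
  by rewrite lap0 ?mulr0.
rewrite psumr_eq0; last first.
  by move=> y _; rewrite mulr_ge0 ?(ltW (pi_gt0 y)) // -expr2 sqr_ge0.
move=> /allP /(_ x (mem_index_enum x)) /=.
by rewrite mulf_eq0 gt_eqF ?pi_gt0 //= mulf_eq0 orbb => /eqP.
Qed.

Variables (E : rel X) (a : X -> X -> R).
Hypotheses (hX : (2 <= #|X|)%N) (hE : weighted_digraph E a).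

Lemma weight_ge0 x y : 0 <= a x y.
Proof.
have [_ _ apos a0] := hE.
by case: (boolP (E x y)) => [/apos/ltW|/a0->].
Qed.

(** Strong connectivity and a second vertex give every vertex an out-edge. *)
Lemma mass_gt0 x : 0 < mass a x.
Proof.
have [_ conn apos _] := hE.
have [y yx] : exists y, y != x.
  have /card_gt0P[y] : (0 < #|predC1 x|)%N by rewrite cardC1 -ltnS prednK // ltnW.
  by exists y.
have /connectP[[|z s] /= path_s last_s] := conn x y.
  by rewrite last_s eqxx in yx.
have /andP[Exz _] := path_s.
rewrite /mass (bigD1 z) //= ltr_pwDl ?apos // sumr_ge0 // => w _.
exact: weight_ge0.
Qed.

Lemma trans_ge0 x y : 0 <= trans a x y.
Proof. by rewrite divr_ge0 ?weight_ge0 // ltW ?mass_gt0. Qed.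

Lemma trans_gt0 x y : E x y -> 0 < trans a x y.
Proof. by move=> Exy; have [_ _ apos _] := hE; rewrite divr_gt0 ?apos ?mass_gt0. Qed.

Lemma trans_sum1 x : \sum_y trans a x y = 1.
Proof. by rewrite -mulr_suml divff // gt_eqF ?mass_gt0. Qed.

(** At an interior maximum the value is an average of values that are not
    larger, so it is also reached at every out-neighbour.  A positive maximum
    would propagate along a path down to the boundary, where [h = 0]. *)
Lemma harmonic_le0 (bX : {set X}) (h : X -> R) :
  bX != set0 ->
  (forall x, x \in bX -> h x = 0) ->
  (forall x, x \notin bX -> real_laplacian (trans a) h x = 0) ->
  forall x, h x <= 0.
Proof.
move=> /set0Pn[b bb] h0 harm x.
case: (@arg_maxP _ _ X b xpredT h isT) => m _ maxm.
apply: le_trans (maxm x isT) _; rewrite leNgt; apply/negP => hm_gt0.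
have step y z : h y = h m -> E y z -> h z = h m.
  move=> hy Eyz.
  have yb : y \notin bX.
    by apply/negP => /h0; rewrite hy => hm0; rewrite hm0 ltxx in hm_gt0.
  have /eqP : \sum_w trans a y w * (h m - h w) = 0.
    under eq_bigr do rewrite mulrBr.
    rewrite sumrB -mulr_suml trans_sum1 mul1r -hy; apply/eqP.
    by rewrite subr_eq0 eq_sym -subr_eq0; apply/eqP/harm.
  rewrite psumr_eq0; last first.
    by move=> w _; rewrite mulr_ge0 ?trans_ge0 // subr_ge0; apply: maxm.
  move=> /allP /(_ z (mem_index_enum z)) /=.
  by rewrite mulf_eq0 gt_eqF ?trans_gt0 //= subr_eq0 => /eqP.
have reach s : forall y, path E y s -> h y = h m -> h (last y s) = h m.
  elim: s => //= z s IHs y /andP[Eyz path_s] hy.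
  by apply: IHs => //; apply: step Eyz.
have [_ conn _ _] := hE; have /connectP[s path_s b_last] := conn m b.
have := reach s m path_s erefl; rewrite -b_last h0 // => hm0.
by rewrite -hm0 ltxx in hm_gt0.
Qed.

Lemma harmonic_eq0 (bX : {set X}) (h : X -> R) :
  bX != set0 ->
  (forall x, x \in bX -> h x = 0) ->
  (forall x, x \notin bX -> real_laplacian (trans a) h x = 0) ->
  forall x, h x = 0.
Proof.
move=> hbX h0 harm x; apply/le_anti/andP; split.
  exact: (@harmonic_le0 bX).
rewrite -oppr_le0; apply: (@harmonic_le0 bX (fun y => - h y)) => // y yb.
  by rewrite h0 ?oppr0.
by rewrite real_laplacianN harm ?oppr0.
Qed.

End RealLaplacian.

(** * Complex functions and block matrices *)

Section Blocks.
Set Implicit Arguments.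
Unset Strict Implicit.
Variables (R : realType) (X : finType).
Implicit Types (p : X -> X -> R) (u : {ffun X -> R[i]}).

Lemma Re_laplacian p u x :
  complex.Re (laplacian p u x) = real_laplacian p (fun y => complex.Re (u y)) x.
Proof.
rewrite ffunE raddfB raddf_sum /=; congr (_ - _); apply: eq_bigr => y _.
by case: (u y) => r s /=; rewrite mul0r subr0.
Qed.

Lemma Im_laplacian p u x :
  complex.Im (laplacian p u x) = real_laplacian p (fun y => complex.Im (u y)) x.
Proof.
rewrite ffunE raddfB raddf_sum /=; congr (_ - _); apply: eq_bigr => y _.
by case: (u y) => r s /=; rewrite mul0r addr0.
Qed.

Lemma restr_eqP (B : {set X}) u v :
  restr B u = restr B v <-> (forall x, x \in B -> u x = v x).
Proof.
split=> [e x xB | e].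
  have := congr1 (fun w : 'cV_#|B| => w (enum_rank_in xB x) 0) e.
  by rewrite !mxE enum_rankK_in.
by apply/colP => i; rewrite !mxE e // enum_valP.
Qed.

Lemma restr0P (B : {set X}) u :
  restr B u = 0 <-> (forall x, x \in B -> u x = 0).
Proof.
have -> : 0 = restr B [ffun=> 0] :> 'cV[R[i]]_#|B|.
  by apply/colP => i; rewrite !mxE ffunE.
by rewrite restr_eqP; split=> e x xB; have := e x xB; rewrite ffunE.
Qed.

Lemma restr_inj (B : {set X}) u v :
  restr (~: B) u = restr (~: B) v -> restr B u = restr B v -> u = v.
Proof.
move=> /restr_eqP eC /restr_eqP e; apply/ffunP => x.
by case: (boolP (x \in B)) => xB; [apply: e | apply: eC; rewrite inE].
Qed.

Definition extend0 (B : {set X}) (v : 'cV[R[i]]_#|B|) : {ffun X -> R[i]} :=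
  [ffun x => \sum_(i < #|B| | enum_val i == x) v i 0].

Lemma extend0_id (B : {set X}) (v : 'cV_#|B|) i : extend0 v (enum_val i) = v i 0.
Proof.
rewrite ffunE (eq_bigl (pred1 i)) ?big_pred1_eq // => j.
exact: (inj_eq enum_val_inj).
Qed.

Lemma extend0_out (B : {set X}) (v : 'cV_#|B|) x : x \notin B -> extend0 v x = 0.
Proof.
move=> xB; rewrite ffunE big_pred0 // => i; apply: contraNF xB => /eqP <-.
exact: enum_valP.
Qed.

Lemma restr_glue (bX : {set X}) (v : 'cV_#|~: bX|) (g : 'cV_#|bX|) :
  exists u, restr (~: bX) u = v /\ restr bX u = g.
Proof.
exists [ffun x => extend0 v x + extend0 g x].
split; apply/colP => i; have := enum_valP i; rewrite !mxE ffunE extend0_id.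
  by rewrite inE => /extend0_out->; rewrite addr0.
by move=> ib; rewrite extend0_out ?add0r // inE negbK.
Qed.

Lemma restr_laplacian p (A bX : {set X}) u :
  restr A (laplacian p u)
  = blockP p A (~: bX) *m restr (~: bX) u + blockP p A bX *m restr bX u
    - restr A u.
Proof.
apply/colP => i; rewrite !mxE ffunE; congr (_ - _).
rewrite (bigID (mem bX)) /= addrC; congr (_ + _).
  rewrite (eq_bigl [in ~: bX]) => [|x]; last by rewrite !inE.
  by rewrite big_enum_val; apply: eq_bigr => j _; rewrite !mxE.
by rewrite big_enum_val; apply: eq_bigr => j _; rewrite !mxE.
Qed.

Lemma restr_laplacian_int p (bX : {set X}) u :
  restr (~: bX) (laplacian p u)
  = blockP p (~: bX) bX *m restr bX u - IP p bX *m restr (~: bX) u.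
Proof.
by rewrite (restr_laplacian _ _ bX) /IP mulmxBl mul1mx opprB addrAC addrC.
Qed.

Lemma restr_laplacian_bnd p (bX : {set X}) u :
  restr bX (laplacian p u)
  = blockP p bX (~: bX) *m restr (~: bX) u
    - (1%:M - blockP p bX bX) *m restr bX u.
Proof. by rewrite (restr_laplacian _ _ bX) mulmxBl mul1mx opprB addrA. Qed.

(** Block multiplication of the interior rows [(- A, B)] of [Delta] with
    [Delta] itself, both read off [restr_laplacian]. *)
Lemma restr_bilaplacian p (bX : {set X}) u :
  restr (~: bX) (laplacian p (laplacian p u))
  = matS p bX *m restr (~: bX) u - matU p bX *m restr bX u.
Proof.
rewrite restr_laplacian_int restr_laplacian_int restr_laplacian_bnd.
rewrite /matS /matU expr2 -[_ * _]/(_ *m _).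
(* Abstracting the two differences keeps them from being distributed below. *)
move: (IP p bX) (1%:M - blockP p bX bX) => A D.
rewrite !mulmxBr !mulmxDl !mulmxA opprB addrACA opprD.
by congr (_ + _); rewrite addrC.
Qed.

Lemma bilaplace_bvpE p (bX : {set X}) f g u :
  bilaplace_bvp p f g u <->
  matS p bX *m restr (~: bX) u = f + matU p bX *m g /\ restr bX u = g.
Proof.
rewrite /bilaplace_bvp restr_bilaplacian; split=> -[e ub]; split=> //.
  by rewrite -e ub subrK.
by rewrite e ub addrK.
Qed.

Lemma matS_IPY p (bX : {set X}) :
  IP p bX \in unitmx -> matS p bX = IP p bX *m IPY p bX.
Proof. by move=> unitA; rewrite /IPY mulmxDr -mulmxA mulKVmx. Qed.

End Blocks.

(** * Invertibility of A and S *)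

Lemma unitmx_ker0 (F : fieldType) (n : nat) (A : 'M[F]_n) :
  (forall v : 'cV_n, A *m v = 0 -> v = 0) -> A \in unitmx.
Proof.
move=> kerA; rewrite -unitmx_tr -row_free_unit; apply/inj_row_free => v.
move=> /(congr1 trmx); rewrite trmx_mul trmxK trmx0 => /kerA /(congr1 trmx).
by rewrite trmxK trmx0.
Qed.

Section Invertibility.
Set Implicit Arguments.
Unset Strict Implicit.
Variables (R : realType) (X : finType) (E : rel X).
Variables (a : X -> X -> R) (bX : {set X}).
Hypotheses (hX : (2 <= #|X|)%N) (hE : weighted_digraph E a).
Hypothesis hbX : bX != set0.
Let p := trans a.

Lemma complex_harmonic_eq0 (u : {ffun X -> R[i]}) :
  restr bX u = 0 -> restr (~: bX) (laplacian p u) = 0 ->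
  forall B : {set X}, restr B u = 0.
Proof.
move=> /restr0P u0 /restr0P lap0 B; apply/restr0P => x _.
have Re0 : complex.Re (u x) = 0.
  apply: (harmonic_eq0 hX hE hbX (h := fun y => complex.Re (u y))) => y yb.
    by rewrite u0.
  by rewrite -Re_laplacian lap0 // inE.
have Im0 : complex.Im (u x) = 0.
  apply: (harmonic_eq0 hX hE hbX (h := fun y => complex.Im (u y))) => y yb.
    by rewrite u0.
  by rewrite -Im_laplacian lap0 // inE.
by apply/eqP; rewrite eq_complex Re0 Im0 !eqxx.
Qed.

Lemma IP_unitmx : IP p bX \in unitmx.
Proof.
apply: unitmx_ker0 => v Av0.
have [u [uv u0]] := restr_glue v 0.
rewrite -uv; apply: complex_harmonic_eq0 => //.
by rewrite restr_laplacian_int uv u0 Av0 mulmx0 subr0.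
Qed.

Lemma reversible_matS_unitmx : reversible p -> matS p bX \in unitmx.
Proof.
move=> rev; apply: unitmx_ker0 => v Sv0.
have [u [uv u0]] := restr_glue v 0.
have /restr0P lap20 : restr (~: bX) (laplacian p (laplacian p u)) = 0.
  by rewrite restr_bilaplacian uv u0 Sv0 mulmx0 subr0.
have /restr0P ub := u0.
rewrite -uv; apply: complex_harmonic_eq0 => //; apply/restr0P => x _.
have Re0 : complex.Re (laplacian p u x) = 0.
  rewrite Re_laplacian; apply: (reversible_biharmonic rev (bX := bX)) => y yb.
    by rewrite ub.
  by rewrite -(eq_real_laplacian p (Re_laplacian p u)) -Re_laplacian lap20 // inE.
have Im0 : complex.Im (laplacian p u x) = 0.
  rewrite Im_laplacian; apply: (reversible_biharmonic rev (bX := bX)) => y yb.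
    by rewrite ub.
  by rewrite -(eq_real_laplacian p (Im_laplacian p u)) -Im_laplacian lap20 // inE.
by apply/eqP; rewrite eq_complex Re0 Im0 !eqxx.
Qed.

End Invertibility.

(** * The boundary value problem *)

Theorem mainTheorem7 (R : realType) (X : finType) (E : rel X)
    (a : X -> X -> R) (bX : {set X})
    (hX : (2 <= #|X|)%N) (hE : weighted_digraph E a) (hbX : bX != set0)
    (f : 'cV[R[i]]_#|~: bX|) (g : 'cV[R[i]]_#|bX|) :
  let p := trans a in
  [/\ (* the inverse defining G exists *)
      IP p bX \in unitmx,
      reversible p -> matS p bX \in unitmx
    & matS p bX \in unitmx ->
      [/\ (* the inverse defining K exists *)
          IPY p bX \in unitmx,
          exists! u : {ffun X -> R[i]}, bilaplace_bvp p f g u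
        & forall u : {ffun X -> R[i]}, bilaplace_bvp p f g u ->
            restr (~: bX) u
            = kernelK p bX *m green p bX *m (f + matU p bX *m g)]].
Proof.
move=> p; have unitA : IP p bX \in unitmx := IP_unitmx hX hE hbX.
split=> // [|unitS]; first exact: (reversible_matS_unitmx hX hE hbX).
have unitK : IPY p bX \in unitmx.
  by move: unitS; rewrite matS_IPY // unitmx_mul => /andP[].
split=> //.
  have [u [uo ub]] :=
    restr_glue (invmx (matS p bX) *m (f + matU p bX *m g)) g.
  exists u; split=> [|v /bilaplace_bvpE[Sv vb]].
    by apply/bilaplace_bvpE; rewrite uo mulKVmx.
  by apply: (restr_inj (B := bX)); rewrite ?ub ?vb // uo -Sv mulKmx.
move=> u /bilaplace_bvpE[<- _]; rewrite matS_IPY // -!mulmxA.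
by rewrite /green mulKmx // /kernelK mulKmx.
Qed.
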